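(* For every positive integer $n$ there exists a constant $C_n \geq 1$, depending only on $n$, such that for every gauge function $h$ and every roof function $R$ on $\mathbb{R}^n$ we have \[ C_n^{-1}\, M_h(R) \;\leq\; \sup_{f \in \mathcal{F}_n(R,h)} \|f\|_1 \;\leq\; C_n\, M_h(R), \] where $\|f\|_1 = \int_{\mathbb{R}^n} f \, dV_n$.
   Context: $V_n$ denotes the volume (Lebesgue) measure on $\mathbb{R}^n$. A cube is a set $c = I_1 \times \cdots \times I_n \subset \mathbb{R}^n$, where the $I_j$ are closed intervals in $\mathbb{R}$ of a common length. A gauge function is a continuous increasing function $h$ defined on $[0,\infty)$ with $h(0)=0$, which satisfies the two conditions: $h(x)/x$ is decreasing in $x$, and $\lim_{x \to 0} h(x)/x = \infty$. (Monotonicity is understood in the non-strict sense.) A roof function is a compactly supported measurable function $R : \mathbb{R}^n \to [0,\infty]$. No integrability is assumed, and $R$ may equal $\infty$ on sets of positive volume. $\mathcal{F}_n(R,h)$ is the class of all measurable functions $f: \mathbb{R}^n \to [0,\infty)$ such that (i) $\int_c f\, dV_n \leq h(V_n(c))$ for every cube $c \subset \mathbb{R}^n$, and (ii) $f \leq R$ $V_n$-almost everywhere in $\mathbb{R}^n$. The quantity $M_h(R)$ is defined by \[ M_h(R) := \inf_{\{c_k\}_k} \Big( \sum_k h(V_n(c_k)) + \int_{\mathbb{R}^n \setminus \cup_k c_k} R \, dV_n \Big), \] the infimum being taken over all countable (possibly finite or empty) families $\{c_k\}_k$ of cubes in $\mathbb{R}^n$. *)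

(* Defs.v *)
From HB Require Import structures.
From mathcomp Require Import all_boot all_order all_algebra.
From mathcomp Require Import all_classical all_reals all_analysis measurable_realfun.

Set Implicit Arguments.
Unset Strict Implicit.
Unset Printing Implicit Defensive.

Import Order.TTheory GRing.Theory Num.Theory.
Import numFieldNormedType.Exports.

Local Open Scope classical_set_scope.
Local Open Scope ring_scope.

Section borel_volume.
Context {R : realType}.
Local Open Scope ereal_scope.
Local Notation mR := (measurableTypeR R).

Definition tuple_of_pair n (p : mR * n.-tuple mR) : n.+1.-tuple mR :=
  [tuple of p.1 :: p.2].

Definition pair_of_tuple n (t : n.+1.-tuple mR) : mR * n.-tuple mR :=
  (thead t, [tuple of behead t]).

Lemma tuple_of_pairK n : cancel (@tuple_of_pair n) (@pair_of_tuple n).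
Proof. by move=> [x t]; congr pair; apply/val_inj. Qed.

Lemma measurable_tuple_of_pair n : measurable_fun setT (@tuple_of_pair n).
Proof. exact: measurable_cons. Qed.

Lemma measurable_pair_of_tuple n : measurable_fun setT (@pair_of_tuple n).
Proof.
apply/measurable_fun_pairP; split; first exact: measurable_tnth.
exact: measurable_behead.
Qed.

Section cons_product.
Context n (m : {sigma_finite_measure set (n.-tuple mR) -> \bar R}).

Definition cons_product : set (n.+1.-tuple mR) -> \bar R :=
  pushforward (lebesgue_measure \x m) (@tuple_of_pair n).

Let cons_product0 : cons_product set0 = 0.
Proof. by rewrite /cons_product /pushforward preimage_set0 measure0. Qed.

Let cons_product_ge0 A : 0 <= cons_product A.
Proof. by apply: integral_ge0 => x _; exact: measure_ge0. Qed.

Let cons_product_sigma_additive : semi_sigma_additive cons_product.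
Proof.
move=> F mF tF mUF; rewrite /cons_product /pushforward preimage_bigcup.
have mpre A : measurable A -> measurable (@tuple_of_pair n @^-1` A).
  by move=> mA; rewrite -[X in measurable X]setTI; exact: measurable_tuple_of_pair.
apply: measure_semi_sigma_additive => [k||]; first exact: mpre.
- apply/trivIsetP => i j _ _ ij; rewrite -preimage_setI.
  by move/trivIsetP : tF => /(_ _ _ _ _ ij) -> //; rewrite preimage_set0.
- by rewrite -preimage_bigcup; exact: mpre.
Qed.

HB.instance Definition _ := isMeasure.Build _ _ _ cons_product
  cons_product0 cons_product_ge0 cons_product_sigma_additive.

Lemma cons_productE (A : set mR) (B : set (n.-tuple mR)) :
  measurable A -> measurable B ->
  cons_product (@pair_of_tuple n @^-1` (A `*` B)) = lebesgue_measure A * m B.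
Proof.
move=> mA mB; rewrite /cons_product /pushforward -comp_preimage.
rewrite (_ : _ \o _ = id) ?preimage_id ?product_measure1E//.
exact/funext/tuple_of_pairK.
Qed.

Let cons_product_sigma_finite : sigma_finite setT cons_product.
Proof.
have /sigma_finiteP[F [TF ndF Foo]] := sigma_finiteT (@lebesgue_measure R).
have /sigma_finiteP[G [TG ndG Goo]] := sigma_finiteT m.
exists (fun k => @pair_of_tuple n @^-1` (F k `*` G k)) => [|k].
  rewrite -preimage_bigcup (_ : \bigcup_k _ = setT) ?preimage_setT//.
  apply/seteqP; split=> // -[x t] _.
  have [i _ Fix] : (\bigcup_k F k) x by rewrite -TF.
  have [j _ Gjt] : (\bigcup_k G k) t by rewrite -TG.
  exists (maxn i j) => //; split => /=.
    by move: x Fix; exact/subsetPset/ndF/leq_maxl.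
  by move: t Gjt; exact/subsetPset/ndG/leq_maxr.
have [mF Fk] := Foo k; have [mG Gk] := Goo k; split.
  rewrite -[X in measurable X]setTI.
  by apply: measurable_pair_of_tuple => //; exact: measurableX.
by rewrite cons_productE// lte_mul_pinfty// ge0_fin_numE.
Qed.

HB.instance Definition _ := Measure_isSigmaFinite.Build _ _ _ cons_product
  cons_product_sigma_finite.

End cons_product.

(* n-fold product of the one-dimensional Lebesgue measure, on Borel sets *)
Fixpoint borel_volume n : {sigma_finite_measure set (n.-tuple mR) -> \bar R} :=
  if n is m.+1 then cons_product (borel_volume m) else \d_[tuple].

Lemma borel_volume_prod n (A : 'I_n -> set mR) :
  (forall i, measurable (A i)) ->
  measurable [set t : n.-tuple mR | forall i, A i (tnth t i)] /\
  borel_volume n [set t | forall i, A i (tnth t i)] =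
    \prod_(i < n) lebesgue_measure (A i).
Proof.
elim: n A => [|n IH] A mA.
  rewrite big_ord0 (_ : [set _ | _] = setT); last first.
    by apply/seteqP; split=> // t _ [].
  by split=> //=; rewrite diracT.
pose B := [set t : n.-tuple mR | forall i, A (lift ord0 i) (tnth t i)].
have [mB BE] := IH (fun i => A (lift ord0 i)) (fun i => mA _).
rewrite (_ : [set _ | _] = @pair_of_tuple n @^-1` (A ord0 `*` B)); last first.
  apply/seteqP; split=> t.
    move=> At; split=> [|i] /=; first exact: At.
    by have := At (lift ord0 i); rewrite [in tnth t _](tuple_eta t) tnthS.
  move=> [/= A0 Bt] i; case: (unliftP ord0 i) => [j|] ->; last exact: A0.
  by rewrite [in tnth t _](tuple_eta t) tnthS; exact: Bt.
split.
  rewrite -[X in measurable X]setTI.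
  by apply: measurable_pair_of_tuple => //; exact: measurableX.
by rewrite big_ord_recl -BE; exact: cons_productE.
Qed.

End borel_volume.

Section space.
Context (R : realType) (n : nat).

(* R^n with the sigma-algebra of Lebesgue measurable sets: the Caratheodory
   sets of the outer measure induced by borel_volume, i.e. its completion *)
Definition Rn : Type := caratheodory_type (@borel_volume R n)^*%mu.

HB.instance Definition _ := Measurable.on Rn.

Definition volume : set Rn -> \bar R :=
  @completed_measure_extension _ _ _ (@borel_volume R n).

HB.instance Definition _ := Measure.on volume.
HB.instance Definition _ := Measure_isSigmaFinite.Build _ _ _ volume
  (@completed_measure_extension_sigma_finite _ _ _ _
    (sigma_finiteT (@borel_volume R n))).

Definition coordinate (x : Rn) (i : 'I_n) : R := tnth x i.

(* Transports sets to 'rV[R]_n, which carries the Euclidean topology *)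
Definition row_of (x : Rn) : 'rV[R]_n := \row_i coordinate x i.

Lemma volume_box (a b : 'I_n -> R) : (forall i, a i <= b i) ->
  volume [set x | forall i, coordinate x i \in `[a i, b i]] =
    (\prod_(i < n) (b i - a i))%:E.
Proof.
move=> ab; have [|mB BE] := @borel_volume_prod R n (fun i => `[a i, b i]%classic).
  by move=> i; exact: measurable_itv.
rewrite -prodEFin.
transitivity (borel_volume n
    [set t : n.-tuple (measurableTypeR R) |
      forall i, `[a i, b i]%classic (tnth t i)]).
  exact: measurable_mu_extE.
rewrite BE; apply: eq_bigr => i _.
rewrite lebesgue_measure_itv/= lte_fin; case: ltP => // ba.
by rewrite (le_anti (introT andP (conj ba (ab i)))) subrr.
Qed.

Definition cube : set (set Rn) :=
  [set c | exists (a : 'I_n -> R) (l : R), 0 <= l /\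
    c = [set x | forall i, coordinate x i \in `[a i, a i + l]]].

Definition roof_function (F : Rn -> \bar R) : Prop :=
  [/\ measurable_fun setT F,
      forall x, (0 <= F x)%E
    & compact (closure (row_of @` [set x | F x != 0%E]))].

(* Only the values of h on [0, +oo[ matter *)
Definition gauge_function (h : R -> R) : Prop :=
  [/\ h 0 = 0,
      {within `[0, +oo[, continuous h},
      {in `[0, +oo[ &, {homo h : x y / x <= y}},
      {in `]0, +oo[ &, {homo (fun x => h x / x) : x y /~ x <= y}}
    & h x / x @[x --> 0^'+] --> +oo].

Definition admissible (F : Rn -> \bar R) (h : R -> R) : set (Rn -> R) :=
  [set f : Rn -> R | [/\ measurable_fun setT f,
      forall x, 0 <= f x,
      forall c, cube c ->
        (\int[volume]_(x in c) (f x)%:E <= (h (fine (volume c)))%:E)%E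
    & {ae volume, forall x, ((f x)%:E <= F x)%E}]].

(* A countable family of cubes is indexed by an arbitrary I : set nat *)
Definition M_h (h : R -> R) (F : Rn -> \bar R) : \bar R :=
  ereal_inf [set v | exists (I : set nat) (c : nat -> set Rn),
    (forall k, I k -> cube (c k)) /\
    v = (\esum_(k in I) (h (fine (volume (c k))))%:E +
         \int[volume]_(x in ~` \bigcup_(k in I) c k) F x)%E].

End space.

(* Main.v *)
(* The upper bound (constant 1) is countable subadditivity. For the lower bound,
   fix a half-open cube containing the support of F and its dyadic subdivision,
   and let max_flow(Q) be the largest mass of a function below F, supported in
   the dyadic cell Q and carrying mass at most h(V(Q')) on every dyadic subcell
   Q'. Rescaling near-optimal functions on the children of Q gives
     max_flow(Q) >= min(h(V(Q)), sum of max_flow over the children of Q).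
   Going down the tree and stopping at the cells with max_flow(Q) >= h(V(Q)),
   the mass is conserved: max_flow of the root dominates the sum of h(V(Q)) over
   the stopped cells plus the sum of max_flow over the cells still active at any
   given depth. As h(x)/x -> oo at 0, small cells satisfy
   max_flow(Q) >= int_Q min(F, N), so that max_flow of the root dominates
   M_h(F). Finally a cube is covered by 2^n dyadic cells of comparable side, so a
   function controlled on dyadic cells is admissible after division by 4^n. *)
Require Import Defs.
From mathcomp Require Import all_boot all_order all_algebra.
From mathcomp Require Import all_classical all_reals all_analysis measurable_realfun.
From mathcomp Require Import ring lra.

Import Order.TTheory GRing.Theory Num.Theory.
Import numFieldNormedType.Exports.

Local Open Scope classical_set_scope.
Local Open Scope ring_scope.

(** * Integrals over finite and countable covers *)

Section integral_cover.
Set Implicit Arguments.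
Unset Strict Implicit.
Context d (T : measurableType d) (R : realType).
Context (mu : {measure set T -> \bar R}) (G : T -> \bar R).
Context (mG : measurable_fun setT G) (G0 : forall x, (0 <= G x)%E).

(** The restriction of [G] to [A] is pointwise at most the sum of its restrictions to the [C i].
    Points where [G] vanishes need no cover, which later allows covering only the support of the
    roof. *)
Lemma ge0_integral_le_cover (I : eqType) (s : seq I) (C : I -> set T) (A : set T) :
  measurable A -> (forall i, measurable (C i)) ->
  (forall x, A x -> G x != 0%E -> exists2 i, i \in s & C i x) ->
  (\int[mu]_(x in A) G x <= \sum_(i <- s) \int[mu]_(x in C i) G x)%E.
Proof.
move=> mA mC AC.
have rG (B : set T) : measurable B -> measurable_fun setT (G \_ B).
  by move=> mB; apply/(measurable_restrictT _ mB); exact: measurable_funTS.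
have rG0 (B : set T) x : (0 <= (G \_ B) x)%E by rewrite patchE; case: ifP.
rewrite integral_mkcond.
under eq_bigr do rewrite integral_mkcond.
rewrite -(ge0_integral_sum _ measurableT) => [|i|i x _].
- apply: (ge0_le_integral _ measurableT) => [x _|||x _].
  + exact: rG0.
  + exact: rG.
  + by apply: emeasurable_sum => i; exact: rG.
  + rewrite patchE; case: ifPn => [|_]; last by apply: sume_ge0 => i _; exact: rG0.
    rewrite inE => Ax.
    have [->|/(AC _ Ax)[i si Cx]] := eqVneq (G x) 0%E.
      by apply: sume_ge0 => i _; exact: rG0.
    rewrite (big_rem i)//= patchE mem_set//.
    by rewrite leeDl//; apply: sume_ge0 => j _; exact: rG0.
- exact: rG.
- exact: rG0.
Qed.

Lemma ge0_integral_bigcup_le (C : nat -> set T) : (forall k, measurable (C k)) ->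
  (\int[mu]_(x in \bigcup_k C k) G x
     <= \sum_(0 <= k <oo) \int[mu]_(x in C k) G x)%E.
Proof.
move=> mC; rewrite seqDU_bigcup_eq ge0_integral_bigcup.
- apply: lee_nneseries => [k _ _|k _]; first by apply: integral_ge0.
  apply: ge0_subset_integral => //; last exact: subset_seqDU.
    exact: seqDU_measurable.
  exact: measurable_funTS.
- exact: seqDU_measurable.
- exact: measurable_funTS.
- by [].
- exact: trivIset_seqDU.
Qed.

End integral_cover.

(** * Half-open dyadic cells and their subdivision *)

Section dyadic_cells.
Set Implicit Arguments.
Unset Strict Implicit.
Context {R : realType} {n : nat}.
Implicit Types (a b : {ffun 'I_n -> R}) (l : R) (s : {ffun 'I_n -> bool}).

Lemma measurable_box (A : 'I_n -> set R) :
  (forall i, measurable (A i)) ->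
  measurable [set x : Rn R n | forall i, A i (coordinate x i)].
Proof.
move=> mA; apply: sub_caratheodory; apply: sub_sigma_algebra.
exact: (borel_volume_prod mA).1.
Qed.

Definition closed_cell a l : set (Rn R n) :=
  [set x | forall i, coordinate x i \in `[a i, a i + l]].

(** Half-open, so that the children of a cell partition it exactly and no null boundaries have to be
    discarded. *)
Definition cell a l : set (Rn R n) :=
  [set x | forall i, coordinate x i \in `[a i, a i + l[].

Lemma cube_closed_cell a l : 0 <= l -> cube (closed_cell a l).
Proof. by move=> l0; exists a, l. Qed.

Lemma measurable_cell a l : measurable (cell a l).
Proof.
exact: (@measurable_box (fun i => `[a i, a i + l[%classic)) => i.
Qed.

Lemma measurable_cube (c : set (Rn R n)) : cube c -> measurable c.
Proof.
move=> [a [l [_ ->]]].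
exact: (@measurable_box (fun i => `[a i, a i + l]%classic)) => i.
Qed.

Lemma sub_closed_cell a l : cell a l `<=` closed_cell a l.
Proof.
by move=> x ax i; have := ax i; rewrite !in_itv/= => /andP[-> /ltW ->].
Qed.

Lemma volume_cube (a : 'I_n -> R) l : 0 <= l ->
  volume [set x : Rn R n | forall i, coordinate x i \in `[a i, a i + l]] =
  (l ^+ n)%:E.
Proof.
move=> l0; rewrite volume_box; last by move=> i; rewrite lerDl.
congr EFin; under eq_bigr do rewrite addrC addKr.
by rewrite prodr_const card_ord.
Qed.

Lemma volume_cell_le a l : 0 <= l -> (volume (cell a l) <= (l ^+ n)%:E)%E.
Proof.
move=> l0; rewrite -(volume_cube a l0); apply: le_measure; rewrite ?inE.
- exact: measurable_cell.
- exact/measurable_cube/cube_closed_cell.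
- exact: sub_closed_cell.
Qed.

Definition child a l s : {ffun 'I_n -> R} := [ffun i => a i + l / 2 *+ s i].

Lemma child_sub a l s : 0 <= l -> cell (child a l s) (l / 2) `<=` cell a l.
Proof.
move=> l0 x xs i; have := xs i; rewrite !in_itv/= ffunE.
by case: (s i); rewrite ?mulr1n ?mulr0n => /andP[? ?]; apply/andP; split; lra.
Qed.

Lemma child_cover a l x : cell a l x -> exists s, cell (child a l s) (l / 2) x.
Proof.
move=> ax; exists [ffun i => a i + l / 2 <= coordinate x i] => i.
have := ax i; rewrite !in_itv/= !ffunE => /andP[? ?].
by case: (lerP (a i + l / 2)) => ?; rewrite ?mulr1n ?mulr0n; apply/andP; split; lra.
Qed.

Lemma child_inj a l s t x : cell (child a l s) (l / 2) x ->
  cell (child a l t) (l / 2) x -> s = t.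
Proof.
move=> xs xt; apply/ffunP => i.
have := xs i; have := xt i; rewrite !in_itv/= !ffunE.
by case: (s i); case: (t i) => //; rewrite ?mulr1n ?mulr0n => /andP[? ?] /andP[? ?];
  exfalso; lra.
Qed.

(** The recursion peels off the first generation: a bound on all descendants of a child is literally
    a bound on the deeper descendants of its parent. *)
Fixpoint descendant k a l b : Prop :=
  if k is k'.+1 then exists s, descendant k' (child a l s) (l / 2) b
  else b = a.

Lemma half_expr l k : l / 2 / 2 ^+ k = l / 2 ^+ k.+1.
Proof. by rewrite exprS invfM mulrA. Qed.

Lemma descendant_sub k a l b : 0 <= l -> descendant k a l b ->
  cell b (l / 2 ^+ k) `<=` cell a l.
Proof.
elim: k a l => [|k IH] a l l0 /=; first by move=> ->; rewrite expr0 divr1.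
move=> [s kb]; rewrite -half_expr.
have l20 : 0 <= l / 2 by lra.
by move=> x bx; apply: (@child_sub a l s l0); exact: IH bx.
Qed.

(** The binary digit of weight [2 ^ k] of [p i] selects the half along axis [i]; the remaining
    digits locate the cell inside that child. *)
Lemma descendant_grid k a l (p : 'I_n -> nat) : (forall i, (p i < 2 ^ k)%N) ->
  descendant k a l [ffun i => a i + l / 2 ^+ k * (p i)%:R].
Proof.
elim: k a l p => [|k IH] a l p pk /=.
  apply/ffunP => i; rewrite ffunE.
  by move: (pk i); rewrite expn0 ltnS leqn0 => /eqP ->; rewrite mulr0 addr0.
exists [ffun i => (2 ^ k <= p i)%N].
have := IH (child a l [ffun i => (2 ^ k <= p i)%N]) (l / 2)
  (fun i => p i - 2 ^ k * (2 ^ k <= p i))%N.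
rewrite (_ : [ffun _ => _] = [ffun i => a i + l / 2 ^+ k.+1 * (p i)%:R]).
  apply => i; case: (leqP (2 ^ k) (p i)) => h; last by rewrite muln0 subn0.
  by rewrite muln1 ltn_subLR// addnn -mul2n -expnS.
apply/ffunP => i; rewrite !ffunE -addrA; congr (_ + _).
have e : l / 2 = l / 2 ^+ k.+1 * (2 ^ k)%:R.
  by rewrite -half_expr natrX mulfVK// expf_neq0// pnatr_eq0.
rewrite half_expr; case: (leqP (2 ^ k) (p i)) => h; last by rewrite mulr0n muln0 subn0 add0r.
by rewrite mulr1n muln1 {1}e -mulrDr -natrD subnKC.
Qed.

End dyadic_cells.

(** * Flows on the dyadic tree *)

Section dyadic_flow.
Set Implicit Arguments.
Unset Strict Implicit.
Context {R : realType} {n : nat}.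
Local Notation vol := (@volume R n).
Context (h : R -> R) (F : Rn R n -> \bar R).
Context (h_ge0 : forall y, 0 <= y -> 0 <= h y) (F_ge0 : forall x, (0 <= F x)%E).
Implicit Types (a b : {ffun 'I_n -> R}) (l : R) (s : {ffun 'I_n -> bool}).
Implicit Types (f g : Rn R n -> R).

(** Compared with [admissible], the bound by [F] holds everywhere rather than almost everywhere, and
    the gauge bound is imposed on dyadic cells only. *)
Definition flow_in a l : set (Rn R n -> R) :=
  [set f : Rn R n -> R | [/\ measurable_fun setT f, forall x, 0 <= f x,
      forall x, ((f x)%:E <= F x)%E,
      forall x, ~ cell a l x -> f x = 0
    & forall k b, descendant k a l b ->
      (\int[vol]_(x in cell b (l / 2 ^+ k)) (f x)%:E
         <= (h ((l / 2 ^+ k) ^+ n))%:E)%E]].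

Definition max_flow a l : \bar R :=
  ereal_sup [set \int[vol]_x (f x)%:E | f in flow_in a l]%E.

Lemma integral_flow_in a l f : (forall x, ~ cell a l x -> f x = 0) ->
  (\int[vol]_x (f x)%:E = \int[vol]_(x in cell a l) (f x)%:E)%E.
Proof.
move=> f0; rewrite [RHS]integral_mkcond; apply: eq_integral => x _.
by rewrite patchE; case: ifPn => //; rewrite notin_setE => /f0 ->.
Qed.

Lemma flow_in_le a l f : flow_in a l f ->
  (\int[vol]_x (f x)%:E <= (h (l ^+ n))%:E)%E.
Proof.
move=> [_ _ _ f0 fh]; rewrite (integral_flow_in f0).
by have := fh 0%N a erefl; rewrite expr0 divr1.
Qed.

Lemma max_flow_le a l : (max_flow a l <= (h (l ^+ n))%:E)%E.
Proof. by apply: ge_ereal_sup => _ [f /flow_in_le fh <-]. Qed.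

Lemma flow_in0 a l : 0 <= l -> flow_in a l (cst 0).
Proof.
move=> l0; split => // k b _.
by rewrite integral0 lee_fin h_ge0// exprn_ge0// divr_ge0// exprn_ge0.
Qed.

Lemma max_flow_ge0 a l : 0 <= l -> (0 <= max_flow a l)%E.
Proof.
move=> l0; apply: ereal_sup_ubound; exists (cst 0); first exact: flow_in0.
by rewrite integral0.
Qed.

Lemma max_flow_fin_num a l : 0 <= l -> max_flow a l \is a fin_num.
Proof.
move=> l0; rewrite ge0_fin_numE ?max_flow_ge0//.
exact: le_lt_trans (max_flow_le _ _) (ltry _).
Qed.

Lemma sum_child a l (fs : {ffun 'I_n -> bool} -> Rn R n -> R) s x :
  (forall t, flow_in (child a l t) (l / 2) (fs t)) ->
  cell (child a l s) (l / 2) x -> \sum_t fs t x = fs s x.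
Proof.
move=> fsP xs; rewrite (bigD1 s)//= big1 ?addr0// => t ts.
have [_ _ _ + _] := fsP t; apply=> xt; move/eqP: ts; apply.
exact: child_inj xt xs.
Qed.

Lemma sum_child0 a l (fs : {ffun 'I_n -> bool} -> Rn R n -> R) x :
  0 <= l -> (forall t, flow_in (child a l t) (l / 2) (fs t)) ->
  ~ cell a l x -> \sum_t fs t x = 0.
Proof.
move=> l0 fsP ax; apply: big1 => t _.
by have [_ _ _ + _] := fsP t; apply=> /(child_sub l0).
Qed.

Lemma measurable_sum_child a l (fs : {ffun 'I_n -> bool} -> Rn R n -> R) :
  (forall t, flow_in (child a l t) (l / 2) (fs t)) ->
  measurable_fun setT (fun x => \sum_t fs t x).
Proof. by move=> fsP; apply: measurable_sum => t; case: (fsP t). Qed.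

Lemma integral_sum_child a l (fs : {ffun 'I_n -> bool} -> Rn R n -> R) :
  (forall t, flow_in (child a l t) (l / 2) (fs t)) ->
  (\int[vol]_x (\sum_t fs t x)%:E = \sum_t \int[vol]_x (fs t x)%:E)%E.
Proof.
move=> fsP; under eq_integral do rewrite -sumEFin.
rewrite (ge0_integral_sum _ measurableT) => [|t|t x _].
- reflexivity.
- by apply/measurable_EFinP; case: (fsP t).
- by rewrite lee_fin; case: (fsP t).
Qed.

(** A factor [k] in [0, 1] preserves the bound by [F] and every bound on proper subcells, since the
    children are disjoint; only the bound on the root cell has to be assumed. *)
Lemma flow_in_sum a l (fs : {ffun 'I_n -> bool} -> Rn R n -> R) (k : R) :
  0 <= l -> (forall t, flow_in (child a l t) (l / 2) (fs t)) ->
  0 <= k <= 1 ->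
  (k%:E * \sum_t \int[vol]_x (fs t x)%:E <= (h (l ^+ n))%:E)%E ->
  flow_in a l (fun x => k * \sum_t fs t x).
Proof.
move=> l0 fsP /andP[k0 k1] kh.
have fs0 t x : 0 <= fs t x by case: (fsP t).
have g0 x : 0 <= \sum_t fs t x by apply: sumr_ge0.
have mg := measurable_sum_child fsP.
have kg x : k * \sum_t fs t x <= \sum_t fs t x by rewrite ler_piMl.
have vanish x : ~ cell a l x -> k * (\sum_t fs t x) = 0.
  by move=> ax; rewrite (sum_child0 l0 fsP ax) mulr0.
split.
- by apply: measurable_funM => //; exact: measurable_cst.
- by move=> x; exact: mulr_ge0.
- move=> x; apply: (@le_trans _ _ (\sum_t fs t x)%:E); first by rewrite lee_fin.
  have [/child_cover[s xs]|ax] := pselect (cell a l x).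
    by rewrite (sum_child fsP xs); case: (fsP s).
  by rewrite (sum_child0 l0 fsP ax).
- exact: vanish.
- move=> [|d] b /=.
    move=> ->; rewrite expr0 divr1 -(integral_flow_in vanish).
    under eq_integral do rewrite EFinM.
    rewrite (ge0_integralZl_EFin _ measurableT) => [|x _||].
    + by rewrite (integral_sum_child fsP).
    + by rewrite lee_fin.
    + exact/measurable_EFinP.
    + exact: k0.
  move=> [s db]; have [mf _ _ _ /(_ _ _ db)] := fsP s.
  rewrite half_expr; apply: le_trans.
  have mb := measurable_cell b (l / 2 ^+ d.+1).
  apply: (ge0_le_integral _ mb).
  + by move=> x _; rewrite lee_fin mulr_ge0.
  + apply: measurable_funTS; apply/measurable_EFinP.
    by apply: measurable_funM => //; exact: measurable_cst.
  + by apply: measurable_funTS; apply/measurable_EFinP.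
  + move=> x bx; have l20 : 0 <= l / 2 by lra.
    have xs : cell (child a l s) (l / 2) x.
      by apply: (descendant_sub l20 db); rewrite half_expr.
    by rewrite lee_fin (le_trans (kg x))// (sum_child fsP xs).
Qed.

(* If the total mass m of the fs exceeds h (l ^+ n), rescale by h (l ^+ n) / m *)
Lemma max_flow_merge a l (fs : {ffun 'I_n -> bool} -> Rn R n -> R) :
  0 <= l -> (forall t, flow_in (child a l t) (l / 2) (fs t)) ->
  (mine (h (l ^+ n))%:E (\sum_t \int[vol]_x (fs t x)%:E)
     <= max_flow a l)%E.
Proof.
move=> l0 fsP.
have hl : 0 <= h (l ^+ n) by rewrite h_ge0 ?exprn_ge0.
have l20 : 0 <= l / 2 by lra.
set m := (\sum_t _)%E.
have m0 : (0 <= m)%E.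
  by apply: sume_ge0 => t _; apply: integral_ge0 => x _; rewrite lee_fin; case: (fsP t).
have mfin : m \is a fin_num.
  rewrite ge0_fin_numE//; apply: lte_sum_pinfty => t _.
  exact: le_lt_trans (flow_in_le (fsP t)) (ltry _).
have key (k : R) : 0 <= k <= 1 -> (k%:E * m <= (h (l ^+ n))%:E)%E ->
    (k%:E * m <= max_flow a l)%E.
  move=> k01 km; apply: ereal_sup_ubound.
  exists (fun x => k * \sum_t fs t x); first exact: flow_in_sum.
  under eq_integral do rewrite EFinM.
  rewrite (ge0_integralZl_EFin _ measurableT).
  - by rewrite (integral_sum_child fsP).
  - by move=> x _; rewrite lee_fin; apply: sumr_ge0 => t _; case: (fsP t).
  - exact/measurable_EFinP/(measurable_sum_child fsP).
  - by case/andP: k01.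
have [r mE] : exists r, m = r%:E by exists (fine m); rewrite fineK.
move: m0 key; rewrite mE !lee_fin => r0 key.
have [hr|rh] := leP (h (l ^+ n))%:E r%:E; last first.
  by rewrite -[r%:E]mul1e; apply: key; rewrite ?mul1e ?ler01 ?lexx// ltW.
rewrite lee_fin in hr.
(* The rescaling factor divides by the mass [r]; if [r] is 0, then [h (l ^+ n)] is 0 too and the
   claim is the nonnegativity of [max_flow]. *)
have [r00|rn0] := eqVneq r 0.
  have -> : h (l ^+ n) = 0 by apply/eqP; rewrite eq_le hl -r00 hr.
  exact: max_flow_ge0.
have rp : 0 < r by rewrite lt_neqAle eq_sym rn0.
have := key (h (l ^+ n) / r); rewrite -EFinM divfK//; apply => //.
by rewrite divr_ge0//= ler_pdivrMr// mul1r.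
Qed.

(** The supremum over each child need not be attained, so flows that are optimal up to [e / N] are
    merged, [N] being the number of children; the total loss is at most [e]. *)
Lemma max_flow_rec a l : 0 <= l ->
  (mine (h (l ^+ n))%:E (\sum_s max_flow (child a l s) (l / 2))
     <= max_flow a l)%E.
Proof.
move=> l0; have l20 : 0 <= l / 2 by lra.
apply/lee_addgt0Pr => e e0.
pose N : R := #|{ffun 'I_n -> bool}|%:R.
have N0 : 0 < N.
  by rewrite ltr0n; apply/card_gt0P; exists [ffun=> true].
have eN0 : 0 < e / N by rewrite divr_gt0.
have pick s : exists f, flow_in (child a l s) (l / 2) f /\
    (max_flow (child a l s) (l / 2) - (e / N)%:E < \int[vol]_x (f x)%:E)%E.
  have [_ [f fP <-] fe] := ub_ereal_sup_adherent eN0 (max_flow_fin_num (child a l s) l20).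
  by exists f.
have /choice[fs fsP] := pick.
have fsF s := (fsP s).1.
apply: le_trans (leeD2r e%:E (max_flow_merge l0 fsF)).
have le1 : (\sum_s max_flow (child a l s) (l / 2) <=
   (\sum_s \int[vol]_x (fs s x)%:E) + e%:E)%E.
  have -> : e%:E = (\sum_(s : {ffun 'I_n -> bool}) (e / N)%:E)%E.
    rewrite sumEFin big_const iter_addr_0 -[_ *+ _]mulr_natr; congr EFin.
    by rewrite divfK// gt_eqF.
  rewrite -big_split/=; apply: lee_sum => s _.
  by rewrite -leeBlDr//; exact/ltW/(fsP s).2.
rewrite -[leRHS]/(_ + _)%E.
have [hm|hm] := leP (h (l ^+ n))%:E (\sum_s \int[vol]_x (fs s x)%:E)%E.
  by rewrite ge_min; apply/orP; left; rewrite leeDl// lee_fin ltW.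
by rewrite ge_min; apply/orP; right.
Qed.

(** The truncation of [F] at height [N], cut off outside the cell, is itself a flow: its mass on a
    subcell is at most [N] times the volume, which [h] dominates by assumption. Truncating also
    makes it finite, so that [fine] loses nothing. *)
Lemma max_flow_small a l (N : R) : 0 <= l -> 0 <= N ->
  measurable_fun setT F ->
  (forall k, N * (l / 2 ^+ k) ^+ n <= h ((l / 2 ^+ k) ^+ n)) ->
  (\int[vol]_(x in cell a l) mine (F x) N%:E <= max_flow a l)%E.
Proof.
move=> l0 N0 mF small.
have ma := measurable_cell a l.
pose G x := mine (F x) N%:E.
have mG : measurable_fun setT G by exact: measurable_mine.
have G0 x : (0 <= G x)%E by rewrite /G le_min F_ge0 lee_fin.
have GN x : (G x <= N%:E)%E by rewrite /G ge_min lexx orbT.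
have Gfin x : G x \is a fin_num.
  by rewrite ge0_fin_numE//; exact: le_lt_trans (GN x) (ltry _).
have mgE : measurable_fun setT (G \_ (cell a l)).
  by apply/(measurable_restrictT _ ma); exact: measurable_funTS.
have gfin x : (G \_ (cell a l)) x \is a fin_num by rewrite patchE; case: ifP.
have gG x : ((G \_ (cell a l)) x <= G x)%E by rewrite patchE; case: ifP.
have g0 x : (0 <= (G \_ (cell a l)) x)%E by rewrite patchE; case: ifP.
rewrite integral_mkcond; apply: ereal_sup_ubound.
exists (fun x => fine ((G \_ (cell a l)) x)); last first.
  by apply: eq_integral => x _; rewrite fineK.
split.
- exact: measurableT_comp mgE.
- by move=> x; rewrite fine_ge0.
- by move=> x; rewrite fineK// (le_trans (gG x))// /G ge_min lexx.
- by move=> x ax; rewrite patchE memNset.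
- move=> k b kb.
  have lk : 0 <= l / 2 ^+ k by rewrite divr_ge0// exprn_ge0.
  apply: (@le_trans _ _ (\int[vol]_(x in cell b (l / 2 ^+ k)) cst N%:E x)%E).
    apply: (ge0_le_integral _ (measurable_cell _ _)).
    + by move=> x _; rewrite lee_fin fine_ge0.
    + apply: measurable_funTS; apply/measurable_EFinP.
      exact: measurableT_comp mgE.
    + exact: measurable_cst.
    + by move=> x _ /=; rewrite fineK// (le_trans (gG x)).
  rewrite integral_cst; last exact: measurable_cell.
  apply: (@le_trans _ _ (N%:E * ((l / 2 ^+ k) ^+ n)%:E)%E).
    by apply: lee_wpmul2l; rewrite ?lee_fin//; exact: volume_cell_le.
  by rewrite -EFinM lee_fin.
Qed.

End dyadic_flow.

(** * Stopping the tree at saturated cells to bound [M_h] by [max_flow] *)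

Section covering.
Set Implicit Arguments.
Unset Strict Implicit.
Context {R : realType} {n : nat}.
Local Notation vol := (@volume R n).
Context (h : R -> R) (F : Rn R n -> \bar R).

Lemma M_h_le_family (T : countType) (J : set T) (c : T -> set (Rn R n)) :
  (forall t, J t -> cube (c t)) ->
  (M_h h F <= \esum_(t in J) (h (fine (vol (c t))))%:E +
     \int[vol]_(x in ~` \bigcup_(t in J) c t) F x)%E.
Proof.
move=> cJ; apply: ereal_inf_lbound.
exists (pickle @` J), (fun k => if unpickle k is Some t then c t else set0).
split=> [_ [t Jt <-]|]; first by rewrite pickleK; exact: cJ.
rewrite bigcup_image esum_image; last first.
  by move=> s t _ _; exact: (pcan_inj pickleK).
congr (_ + _)%E; first by apply: eq_esum => t _; rewrite pickleK.
by congr (\int[vol]_(x in ~` _) F x)%E; apply: eq_bigcupr => t _; rewrite pickleK.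
Qed.

Context (h_ge0 : forall y, 0 <= y -> 0 <= h y) (F_ge0 : forall x, (0 <= F x)%E).
Context (mF : measurable_fun setT F).
Context (a : {ffun 'I_n -> R}) (l : R) (l_ge0 : 0 <= l).
Implicit Types (b : {ffun 'I_n -> R}) (s : {ffun 'I_n -> bool}) (d : nat).

Local Notation side d := (l / 2 ^+ d).

Lemma side_ge0 d : 0 <= side d.
Proof. by rewrite divr_ge0// exprn_ge0. Qed.

Lemma side_half d : side d / 2 = side d.+1.
Proof. by rewrite exprSr invfM mulrA. Qed.

(** By [max_flow_le], this inequality amounts to equality. *)
Definition saturated d b : bool :=
  ((h (side d ^+ n))%:E <= max_flow h F b (side d))%E.

Fixpoint active d : seq {ffun 'I_n -> R} :=
  if d is d'.+1
  then [seq child b (side d') s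
         | b <- [seq b <- active d' | ~~ saturated d' b],
           s <- index_enum {ffun 'I_n -> bool}]
  else [:: a].

Definition stopped d := [seq b <- active d | saturated d b].

(** Passing from depth [D] to [D.+1], a saturated cell pays [h] out of its own maximal flow. For an
    unsaturated one the minimum in [max_flow_rec] cannot be [h], so its children together carry no
    more than it does. *)
Lemma active_conservation D :
  (\sum_(d < D) \sum_(b <- stopped d) (h (side d ^+ n))%:E +
   \sum_(b <- active D) max_flow h F b (side D) <= max_flow h F a l)%E.
Proof.
elim: D => [|D IH].
  by rewrite big_ord0 add0e big_seq1 expr0 divr1.
apply: le_trans IH; rewrite big_ord_recr/= -addeA; apply: leeD2l.
rewrite [leRHS](bigID (saturated D))/= -[in leRHS]big_filter.
apply: leeD.
  rewrite /stopped !big_seq; apply: lee_sum => b.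
  by rewrite mem_filter => /andP[].
rewrite big_allpairs_dep/= big_filter; apply: lee_sum => b sb.
have := max_flow_rec h_ge0 F_ge0 b (side_ge0 D).
rewrite ge_min side_half => /orP[hb|//].
by move: sb; rewrite /saturated hb.
Qed.

Lemma active_cover D x : cell a l x ->
  (exists d b, b \in stopped d /\ cell b (side d) x) \/
  (exists b, b \in active D /\ cell b (side D) x).
Proof.
move=> ax; elim: D => [|D [|[b [bD bx]]]]; [right|by left|].
  by exists a; rewrite /= inE eqxx expr0 divr1.
have [sb|sb] := boolP (saturated D b).
  by left; exists D, b; rewrite mem_filter sb.
right; have [s sx] := child_cover bx; exists (child b (side D) s).
rewrite -side_half; split=> //=.
by apply: allpairs_f; rewrite ?mem_filter ?sb// mem_index_enum.
Qed.

(* The stopped cells are indexed by their depth and their rank at this depth *)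
Definition stopped_index : set (nat * nat) := setT `*`` (fun d => `I_(size (stopped d))).
(** Closed, since [M_h] asks for closed cubes. The default [a] of [nth] is not reached on
    [stopped_index]. *)
Definition stopped_cube (p : nat * nat) : set (Rn R n) :=
  closed_cell (nth a (stopped p.1) p.2) (side p.1).
Definition stopped_union := \bigcup_(p in stopped_index) stopped_cube p.

Lemma measurable_stopped_union : measurable stopped_union.
Proof.
rewrite /stopped_union bigcup_mkcond; apply: countable_bigcupT_measurable => //.
move=> p; case: ifP => _; last exact: measurable0.
exact/measurable_cube/cube_closed_cell/side_ge0.
Qed.

(** Summation over pairs is regrouped by depth. Indexing by rank counts list entries with
    multiplicity on both sides, so no uniqueness of the entries has to be shown. *)
Lemma esum_stopped :
  (\esum_(p in stopped_index) (h (fine (vol (stopped_cube p))))%:E =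
   \sum_(0 <= d <oo) \sum_(b <- stopped d) (h (side d ^+ n))%:E)%E.
Proof.
have hs d : (0 <= (h (side d ^+ n))%:E)%E.
  by rewrite lee_fin h_ge0// exprn_ge0// side_ge0.
rewrite nneseries_esumT; last by move=> d; apply: sume_ge0.
rewrite [LHS](_ : _ = \esum_(p in stopped_index) (h (side p.1 ^+ n))%:E)%E; last first.
  by apply: eq_esum => p _; rewrite volume_cube// side_ge0.
rewrite -(esum_esum (fun d _ _ _ => hs d)).
apply: eq_esum => d _.
rewrite esum_fset//.
by rewrite -fsbig_ord (big_nth a) big_mkord.
Qed.

Hypothesis F_cell : forall x, F x != 0%E -> cell a l x.

(** Off the stopped cubes, every point of the support of [F] lies in an active cell of depth [D],
    and [max_flow_small] applies to each of these cells. *)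
Lemma truncated_integral_le D (N : R) : 0 <= N ->
  (forall k, N * side (D + k) ^+ n <= h (side (D + k) ^+ n)) ->
  (\int[vol]_(x in ~` stopped_union) mine (F x) N%:E
     <= \sum_(b <- active D) max_flow h F b (side D))%E.
Proof.
move=> N0 small.
pose G x := mine (F x) N%:E.
have mG : measurable_fun setT G by exact: measurable_mine.
have G0 x : (0 <= G x)%E by rewrite /G le_min F_ge0 lee_fin.
apply: (@le_trans _ _ (\sum_(b <- active D) \int[vol]_(x in cell b (side D)) G x)%E); last first.
  apply: lee_sum => b _; apply: max_flow_small; rewrite ?side_ge0// => k.
  rewrite [X in N * X ^+ n](_ : _ = side (D + k)).
    rewrite [X in h (X ^+ n)](_ : _ = side (D + k))//.
    by rewrite exprD invfM mulrA.
  by rewrite exprD invfM mulrA.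
apply: ge0_integral_le_cover => //; first exact/measurableC/measurable_stopped_union.
  by move=> b; exact: measurable_cell.
move=> x Wx Gx; have Fx : F x != 0%E.
  apply: contraNneq Gx => Fx0; rewrite /G Fx0; apply/eqP/min_idPl.
  by rewrite lee_fin.
have [[d [b [bd bx]]]|[b [bD bx]]] := active_cover D (F_cell Fx); last by exists b.
exfalso; apply: Wx; exists (d, index b (stopped d)).
  by split => //=; rewrite index_mem.
by rewrite /stopped_cube/= nth_index//; exact: sub_closed_cell.
Qed.

(** Two limits are taken in turn: the depth goes to infinity for a fixed truncation height [N], then
    [N] does. The truncation is what copes with a roof that is infinite or not integrable. *)
Lemma M_h_le_max_flow :
  (forall N : R, exists D, forall k,
     N * side (D + k) ^+ n <= h (side (D + k) ^+ n)) ->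
  (M_h h F <= max_flow h F a l)%E.
Proof.
move=> small.
apply: le_trans (@M_h_le_family _ stopped_index stopped_cube _) _.
  by move=> p _; exact/cube_closed_cell/side_ge0.
rewrite esum_stopped -/stopped_union; set T := (\sum_(0 <= d <oo) _)%E.
set S := max_flow h F a l.
have Sfin : S \is a fin_num by exact: max_flow_fin_num.
have hs d : (0 <= \sum_(b <- stopped d) (h (side d ^+ n))%:E)%E.
  by apply: sume_ge0 => b _; rewrite lee_fin h_ge0// exprn_ge0// side_ge0.
pose G (N : nat) x := mine (F x) N%:R%:E.
have G0 N x : (0 <= G N x)%E by rewrite /G le_min F_ge0 lee_fin/=.
have mW := measurableC measurable_stopped_union.
have partial N D : (\sum_(d < D) \sum_(b <- stopped d) (h (side d ^+ n))%:E +
    \int[vol]_(x in ~` stopped_union) G N x <= S)%E.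
  have [E0 E0P] := small N%:R.
  (* Conservation is used at a depth beyond [E0], where cells are small enough for the height [N];
     the extra stopped terms are nonnegative. *)
  have := active_conservation (maxn D E0); apply: le_trans; apply: leeD.
    rewrite -!(big_mkord xpredT (fun d => \sum_(b <- stopped d) (h (side d ^+ n))%:E)%E).
    by apply: lee_sum_nneg_natr => //; rewrite leq_maxl.
  apply: truncated_integral_le => // k.
  have := E0P (maxn D E0 - E0 + k)%N.
  by rewrite addnA subnKC// leq_maxr.
(* Finiteness, here and for [T] below, allows moving these terms across the inequality by
   subtraction in the extended reals. *)
have Gfin N : (\int[vol]_(x in ~` stopped_union) G N x)%E \is a fin_num.
  rewrite ge0_fin_numE; last by apply: integral_ge0.
  apply: le_lt_trans (_ : S < +oo)%E; last by rewrite ltey_eq Sfin.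
  by have := partial N 0%N; rewrite big_ord0 add0e.
have TG N : (T + \int[vol]_(x in ~` stopped_union) G N x <= S)%E.
  rewrite -leeBrDr//; apply: lime_le; first exact: is_cvg_nneseries.
  by apply: nearW => D; rewrite big_mkord leeBrDr.
have T0 : (0 <= T)%E by exact: nneseries_ge0.
have Tfin : T \is a fin_num.
  rewrite ge0_fin_numE//; apply: le_lt_trans (_ : S < +oo)%E; last first.
    by rewrite ltey_eq Sfin.
  by apply: le_trans (TG 0%N); rewrite leeDl// integral_ge0.
rewrite addeC -leeBrDr//.
(* Where [F x] is finite the truncations are eventually constant; where it is infinite they equal
   [N]. *)
have GF x : G ^~ x @ \oo --> F x.
  rewrite /G; case: (F x) (F_ge0 x) => [r _|_|//].
    apply: cvg_near_cst; near=> N; apply/min_idPl; rewrite lee_fin ltW//.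
    by near: N; exact: nbhs_infty_gtr.
  have -> : (fun N : nat => mine +oo%E N%:R%:E) = (fun N => (N%:R : R)%:E).
    by apply/funext => N; apply/min_idPr; exact: leey.
  exact/cvgeryP/cvgr_idn.
have GN N : measurable_fun (~` stopped_union) (G N).
  by apply: measurable_funTS; exact: measurable_mine.
have Gnd x : (~` stopped_union) x -> {homo G ^~ x : N M / (N <= M)%N >-> (N <= M)%E}.
  move=> _ N M NM; rewrite /G le_min ge_min lexx/= ge_min.
  by rewrite orbC lee_fin ler_nat NM.
have cvgG := @cvg_monotone_convergence _ _ _ vol _ mW _ GN (fun N x _ => G0 N x) Gnd.
rewrite (eq_integral (fun x => limn (G ^~ x))); last first.
  by move=> x _; apply/esym/cvg_lim => //; exact: GF.
rewrite -(cvg_lim _ cvgG)//; apply: lime_le; first exact: cvgP cvgG.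
by apply: nearW => N; rewrite leeBrDr// addeC.
Unshelve. all: end_near. Qed.

End covering.

(** * Consequences of the gauge conditions *)

Section gauge.
Set Implicit Arguments.
Unset Strict Implicit.
Context {R : realType} (h : R -> R) (hG : gauge_function h).

Lemma gauge_mono x y : 0 <= x -> x <= y -> h x <= h y.
Proof.
move=> x0 xy; have [_ _ + _ _] := hG; apply => //; rewrite in_itv/= andbT//.
exact: le_trans x0 xy.
Qed.

Lemma gauge_ge0 x : 0 <= x -> 0 <= h x.
Proof.
by move=> x0; have [h0 _ _ _ _] := hG; rewrite -[leLHS]h0; exact: gauge_mono.
Qed.

(** This is the monotonicity of [h x / x] between [x] and [c * x], with denominators cleared. *)
Lemma gauge_scale c x : 1 <= c -> 0 < x -> h (c * x) <= c * h x.
Proof.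
move=> c1 x0; have c0 : 0 < c by lra.
have [_ _ _ + _] := hG => /(_ (c * x) x).
rewrite !in_itv/= !andbT x0 mulr_gt0// => /(_ isT isT).
rewrite (ler_peMl (ltW x0) c1) => /(_ isT).
by rewrite ler_pdivrMr ?mulr_gt0// mulrCA divfK// gt_eqF.
Qed.

Lemma gauge_steep n (N l : R) : (0 < n)%N -> 0 < l ->
  exists D, forall k,
    N * (l / 2 ^+ (D + k)) ^+ n <= h ((l / 2 ^+ (D + k)) ^+ n).
Proof.
move=> n0 l0; have [_ _ _ _ /cvgryPge/(_ N)[e /= e0 He]] := hG.
(* A side [t] below [e] makes [h] steep at [t]; having [t] below 1 as well gives [t ^+ n <= t] for
   positive [n], so the volume is below [e] too. *)
pose m := Num.min 1 e.
have m0 : 0 < m by rewrite lt_min ltr01.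
(* With this [D], [l / m < D <= 2 ^ D], hence [l / 2 ^+ (D + k) < m] for every [k]. *)
exists (Num.bound (l / m)) => k; set D := Num.bound _.
have lm : l / 2 ^+ (D + k) < m.
  rewrite ltr_pdivrMr ?exprn_gt0// -ltr_pdivrMl// mulrC.
  apply: (lt_le_trans (archi_boundP _)); first by rewrite divr_ge0// ltW.
  rewrite -natrX ler_nat (leq_trans (ltnW (ltn_expl D (ltnSn 1))))//.
  by rewrite leq_exp2l// leq_addr.
set t := l / _ in lm *.
have t0 : 0 < t by rewrite divr_gt0// exprn_gt0.
have tn0 : 0 < t ^+ n by rewrite exprn_gt0.
move: lm; rewrite lt_min => /andP[t1 te].
rewrite -ler_pdivlMr//; apply: He => //=.
rewrite sub0r normrN gtr0_norm//; apply: le_lt_trans te.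
by apply: ler_iXnr; rewrite // ltW.
Qed.

End gauge.

(** * From dyadic cells to arbitrary cubes *)

Lemma dyadic_side (R : realType) (r l : R) : 0 < r -> r < l ->
  exists k, l / 2 ^+ k.+1 <= r < l / 2 ^+ k.
Proof.
move=> r0 rl; have l0 : 0 < l := lt_trans r0 rl.
have ex : exists k, l / 2 ^+ k <= r.
  exists (Num.bound (l / r)); rewrite ler_pdivrMr ?exprn_gt0// -ler_pdivrMl// mulrC.
  apply/ltW/(lt_le_trans (archi_boundP _)); first by rewrite divr_ge0// ltW.
  by rewrite -natrX ler_nat ltnW// ltn_expl.
(* The least exponent with [l / 2 ^+ k <= r] is positive because [r < l]; its predecessor is the
   witness. *)
case: (ex_minnP ex) => -[|k] kr kmin.
  by move: kr; rewrite expr0 divr1 leNgt rl.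
exists k; rewrite kr/= ltNge; apply/negP => /kmin.
by rewrite ltnn.
Qed.

Section cube_bound.
Set Implicit Arguments.
Unset Strict Implicit.
Context {R : realType} {n : nat}.
Local Notation vol := (@volume R n).
Context (h : R -> R) (hG : gauge_function h) (F : Rn R n -> \bar R).
Context (a : {ffun 'I_n -> R}) (l : R) (l_gt0 : 0 < l) (f : Rn R n -> R).
Context (fP : flow_in h F a l f).

Let mf : measurable_fun setT (EFin \o f).
Proof. by apply/measurable_EFinP; case: fP. Qed.

Let f0 x : (0 <= (f x)%:E)%E.
Proof. by rewrite lee_fin; case: fP. Qed.

(* Grid cells outside the root carry no mass, the other ones are descendants *)
Lemma flow_grid_cell_le k (p : 'I_n -> int) :
  (\int[vol]_(x in cell [ffun i => (a i + l / 2 ^+ k * (p i)%:~R)%R] (l / 2 ^+ k))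
     (f x)%:E <= (h ((l / 2 ^+ k) ^+ n))%:E)%E.
Proof.
have [_ _ _ fa fh] := fP.
have d0 : 0 < l / 2 ^+ k by rewrite divr_gt0// exprn_gt0.
have [pk|] := pselect (forall i, 0 <= p i < (2 ^ k)%N).
  have -> : [ffun i => a i + l / 2 ^+ k * (p i)%:~R] =
      [ffun i => a i + l / 2 ^+ k * (`|p i|%N)%:R].
    apply/ffunP => i; rewrite !ffunE; have /andP[pi0 _] := pk i.
    by rewrite -[in LHS](gez0_abs pi0).
  apply: fh; apply: descendant_grid => i; have /andP[pi0] := pk i.
  by rewrite -{1}(gez0_abs pi0).
move=> /existsNP[i pi].
rewrite [leLHS](_ : _ = 0%E).
  by rewrite lee_fin gauge_ge0// exprn_ge0// ltW.
apply: integral0_eq => x xc; rewrite fa// => xa; apply: pi.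
have := xc i; have := xa i; rewrite !in_itv/= ffunE.
move: d0 (l_gt0); set d := l / _ => d0 _ /andP[xa1 xa2] /andP[xc1 xc2].
have lE : l = d * (2 ^ k)%:R by rewrite natrX /d divfK// expf_neq0// pnatr_eq0.
(* A common point of the grid cell and the root forces [0 < p i + 1] and [p i < 2 ^ k]; over the
   integers this puts [p i] in range, contrary to its choice. *)
have h1 : d * 0 < d * (p i + 1)%:~R.
  by rewrite mulr0 intrD mulrDr mulr1; lra.
have h2 : d * (p i)%:~R < d * (2 ^ k)%:R by rewrite -lE; lra.
move: h1 h2; rewrite !ltr_pM2l// => h1 h2; apply/andP; split.
  by move: h1; rewrite ltr0z ltzD1.
by move: h2; rewrite -[X in _ < X]/((2 ^ k)%N%:~R) ltr_int.
Qed.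

(** An interval shorter than the grid step meets at most two consecutive grid intervals, so [2 ^ n]
    grid cells cover the cube. *)
Lemma flow_small_cube_le k (b : 'I_n -> R) r : 0 <= r -> r < l / 2 ^+ k ->
  (\int[vol]_(x in [set x : Rn R n | forall i, coordinate x i \in `[b i, (b i + r)%R]])
     (f x)%:E <= (2 ^+ n * h ((l / 2 ^+ k) ^+ n))%:E)%E.
Proof.
move=> r0 rk.
have d0 : 0 < l / 2 ^+ k by rewrite divr_gt0// exprn_gt0.
(* Index of the grid interval containing [b i]; the bit [s i] then chooses between it and the next
   one. *)
pose q i := Num.floor ((b i - a i) / (l / 2 ^+ k)).
pose C (s : {ffun 'I_n -> bool}) :=
  cell [ffun i => a i + l / 2 ^+ k * (q i + (s i)%:Z)%:~R] (l / 2 ^+ k).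
have cC : (\int[vol]_(x in [set x : Rn R n | forall i, coordinate x i \in `[b i, (b i + r)%R]])
     (f x)%:E <= \sum_(s : {ffun 'I_n -> bool}) \int[vol]_(x in C s) (f x)%:E)%E.
  apply: ge0_integral_le_cover => //.
  - by apply: measurable_cube; exists b, r.
  - by move=> s; exact: measurable_cell.
  - move=> x bx _; pose e i := a i + l / 2 ^+ k * (q i + 1)%:~R.
    exists [ffun i => e i <= coordinate x i]; first exact: mem_index_enum.
    move=> i; have := bx i; rewrite !in_itv/= !ffunE => /andP[bx1 bx2].
    have := floor_itv ((b i - a i) / (l / 2 ^+ k)); rewrite -/(q i).
    rewrite ler_pdivlMr// ltr_pdivrMr// => /andP[q1 q2].
    have q3 : (q i + 1)%:~R = (q i)%:~R + 1 :> R by rewrite intrD.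
    case: (lerP (e i)); rewrite /e => ei.
      apply/andP; split => //; move: q2; rewrite q3; lra.
    rewrite addr0; apply/andP; split; first by lra.
    by move: ei; rewrite q3; lra.
apply: le_trans cC _.
apply: (@le_trans _ _ (\sum_(s : {ffun 'I_n -> bool}) (h ((l / 2 ^+ k) ^+ n))%:E)%E).
  by apply: lee_sum => s _; exact: (flow_grid_cell_le k (fun i => q i + (s i)%:Z)).
rewrite sumEFin lee_fin sumr_const card_ffun card_bool card_ord.
by rewrite -[leLHS]mulr_natl natrX.
Qed.

(** One factor [2 ^+ n] counts the covering cells; the other comes from [gauge_scale], as the cells
    have at most twice the side of the cube. A cube wider than the root is bounded by the total
    mass, and a degenerate one is null. *)
Lemma flow_cube_le (n_gt0 : (0 < n)%N) c : cube c ->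
  (\int[vol]_(x in c) (f x)%:E <= (4 ^+ n * h (fine (vol c)))%:E)%E.
Proof.
move=> cc; have mc := measurable_cube cc; case: cc => b [r [r0 cE]].
have vc : vol c = (r ^+ n)%:E by rewrite cE volume_cube.
rewrite vc/=; have hr : 0 <= h (r ^+ n) by rewrite gauge_ge0 ?exprn_ge0.
have n4 : 1 <= 4 ^+ n :> R by rewrite exprn_ege1// (ler_nat _ 1 4).
have [r00|rn0] := eqVneq r 0.
  rewrite (null_set_integral mc).
  - by rewrite lee_fin mulr_ge0// exprn_ge0.
  - exact: measurable_funTS.
  - by rewrite [LHS]vc r00 expr0n gtn_eqF.
have rp : 0 < r by rewrite lt_neqAle eq_sym rn0.
have [lr|rl] := leP l r.
  apply: (@le_trans _ _ (\int[vol]_x (f x)%:E)%E).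
    by apply: ge0_subset_integral.
  apply: (le_trans (flow_in_le fP)); rewrite lee_fin.
  apply: (@le_trans _ _ (h (r ^+ n))); last by rewrite ler_peMl.
  apply: (gauge_mono hG); first by rewrite exprn_ge0// ltW.
  by rewrite lerXn2r// nnegrE ltW.
have [k /andP[kr rk]] := dyadic_side rp rl.
rewrite cE; apply: (le_trans (flow_small_cube_le b r0 rk)).
rewrite lee_fin (_ : 4 = 2 * 2); last by rewrite -natrM.
rewrite [(2 * 2) ^+ n]exprMn -mulrA ler_pM2l ?exprn_gt0//.
have d0 : 0 < l / 2 ^+ k.+1 by rewrite divr_gt0// exprn_gt0.
have -> : (l / 2 ^+ k) ^+ n = 2 ^+ n * (l / 2 ^+ k.+1) ^+ n.
  by rewrite -exprMn exprS invfM; congr (_ ^+ _); field; rewrite expf_neq0// pnatr_eq0.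
apply: (le_trans (gauge_scale hG _ _)).
- by rewrite exprn_ege1// (ler_nat _ 1 2).
- by rewrite exprn_gt0.
- rewrite ler_pM2l ?exprn_gt0//; apply: (gauge_mono hG).
    by rewrite exprn_ge0// ltW.
  by rewrite lerXn2r// nnegrE ltW.
Qed.

End cube_bound.

(** * Admissible functions against covers, and boundedness of the support *)

Section roof.
Set Implicit Arguments.
Unset Strict Implicit.
Context {R : realType} {n : nat}.

(** For any competing family, the mass on the union is bounded by subadditivity and the cube
    condition, and the mass off the union by the roof. *)
Lemma admissible_integral_le_M_h (h : R -> R) (F : Rn R n -> \bar R)
    (f : Rn R n -> R) :
  gauge_function h -> roof_function F -> admissible F h f ->
  (\int[@volume R n]_x (f x)%:E <= M_h h F)%E.
Proof.
move=> hG [mF F0 _] [mf f0 fc fF].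
apply: le_ereal_inf_tmp => _ [I [c [cI ->]]].
(* Empty sets outside [I] turn the family into a full sequence without changing the union or the
   sum. *)
pose c' k := if k \in I then c k else set0.
have mc' k : measurable (c' k).
  rewrite /c'; case: ifPn => [|_]; last exact: measurable0.
  by rewrite inE => /cI; exact: measurable_cube.
pose U := \bigcup_k c' k; rewrite bigcup_mkcond -/U.
have mU : measurable U by exact: bigcup_measurable.
have mEf : measurable_fun setT (EFin \o f) by exact/measurable_EFinP.
have Ef0 x : (0 <= (f x)%:E)%E by rewrite lee_fin.
rewrite -(setUv U) ge0_integral_setU; last first.
- by apply/disj_setPCl.
- by [].
- exact: measurable_funTS.
- exact: measurableC.
- exact: mU.
apply: leeD.
  apply: (le_trans (ge0_integral_bigcup_le _ mEf Ef0 mc')).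
  rewrite esum_mkcond -nneseries_esumT; last first.
    move=> k; case: ifPn => // kI; rewrite lee_fin (gauge_ge0 hG)//.
    exact/fine_ge0/measure_ge0.
  apply: lee_nneseries => [k _ _|k _].
    by apply: integral_ge0 => x _; exact: Ef0.
  rewrite /c'; case: ifPn => [|_]; last by rewrite integral_set0.
  by rewrite inE => kI; exact/fc/cI.
have mCU := measurableC mU.
apply: (@ae_ge0_le_integral _ _ _ _ _ mCU (EFin \o f) F) => [x _||x _||].
- exact: Ef0.
- exact: measurable_funTS.
- exact: F0.
- exact: measurable_funTS.
- by apply: filterS fF => x.
Qed.

(** A compact set is bounded, and the norm of a row vector is the maximum of its entries in absolute
    value. *)
Lemma roof_function_bounded (F : Rn R n -> \bar R) :
  roof_function F -> exists2 B, 0 <= B &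
    forall x, F x != 0%E -> forall i, `|coordinate x i| <= B.
Proof.
move=> [_ _ /compact_bounded[M [_ HM]]].
exists (Num.max 0 (M + 1)); first by rewrite le_max lexx.
move=> x Fx i.
have Mb : M < Num.max 0 (M + 1) by rewrite lt_max ltrDl ltr01 orbT.
have rB : `|row_of x| <= Num.max 0 (M + 1).
  by apply: (HM _ Mb); apply: subset_closure; exists x.
apply: le_trans rB.
rewrite [leRHS](mx_normrE (row_of x)) (_ : coordinate x i = row_of x ord0 i).
  exact: (le_bigmax _ (fun ij => `|row_of x ij.1 ij.2|) (ord0, i)).
by rewrite mxE.
Qed.

End roof.

(** * The two-sided estimate with constant [4 ^+ n] *)

Theorem theorem1p2 (R : realType) (n : nat) (n_gt0 : (0 < n)%N) :
  exists C : R, 1 <= C /\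
    forall (h : R -> R) (F : Rn R n -> \bar R),
      gauge_function h -> roof_function F ->
      (C^-1%:E * M_h h F
         <= ereal_sup [set \int[@volume R n]_x (f x)%:E | f in admissible F h]
         <= C%:E * M_h h F)%E.
Proof.
have C1 : 1 <= 4 ^+ n :> R by rewrite exprn_ege1// (ler_nat _ 1 4).
have C0 : 0 < 4 ^+ n :> R by rewrite exprn_gt0.
exists (4 ^+ n); split=> // h F hG roofF.
have [mF F0 _] := roofF.
have h0 := gauge_ge0 hG.
apply/andP; split; last first.
  have M0 : (0 <= M_h h F)%E.
    apply: le_ereal_inf_tmp => _ [I [c [_ ->]]]; apply: adde_ge0.
      apply: esum_ge0 => k _; rewrite lee_fin h0//.
      exact/fine_ge0/measure_ge0.
    by apply: integral_ge0 => x _; exact: F0.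
  apply: (@le_trans _ _ (M_h h F)); last by rewrite lee_pemull ?lee_fin.
  by apply: ge_ereal_sup => _ [f fA <-]; exact: admissible_integral_le_M_h.
have [B B0 FB] := roof_function_bounded roofF.
pose a : {ffun 'I_n -> R} := [ffun => - B].
(* The extra 1 keeps points with a coordinate equal to [B] inside the half-open root and makes [l]
   positive even if [B] is 0. *)
pose l := 2 * B + 1.
have l0 : 0 < l by rewrite /l; lra.
have Fcell x : F x != 0%E -> cell a l x.
  move=> Fx i; rewrite in_itv/= ffunE; have := FB x Fx i.
  by rewrite ler_norml /l => /andP[? ?]; apply/andP; split; lra.
rewrite lee_pdivrMl//.
have steep N := gauge_steep hG N n_gt0 l0.
apply: (le_trans (M_h_le_max_flow h0 F0 mF (ltW l0) Fcell steep)).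
apply: ge_ereal_sup => _ [f fP <-].
have [mf f0 fF _ _] := fP.
rewrite -lee_pdivrMl//.
have mEf : measurable_fun setT (EFin \o f) by exact/measurable_EFinP.
have Ci0 : 0 <= (4 ^+ n)^-1 :> R by rewrite invr_ge0 ltW.
have scale (A : set (Rn R n)) : measurable A ->
    (\int[@volume R n]_(x in A) ((4 ^+ n)^-1 * f x)%:E =
     (4 ^+ n)^-1%:E * \int[@volume R n]_(x in A) (f x)%:E)%E.
  move=> mA; under eq_integral do rewrite EFinM.
  rewrite (ge0_integralZl_EFin _ mA); [by []| |exact: measurable_funTS|exact: Ci0].
  by move=> x _; rewrite lee_fin.
(* Division by [4 ^+ n] absorbs the constant of [flow_cube_le], and the function stays below [F]. *)
apply: ereal_sup_ubound; exists (fun x => (4 ^+ n)^-1 * f x); last first.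
  exact: scale measurableT.
split.
- by apply: measurable_funM => //; exact: measurable_cst.
- by move=> x; rewrite mulr_ge0.
- move=> c cc; rewrite scale; last exact: measurable_cube.
  by rewrite lee_pdivrMl// -EFinM; exact: (flow_cube_le hG l0 fP n_gt0 cc).
- apply: aeW => x; apply: le_trans (fF x).
  by rewrite lee_fin ler_piMl// invf_le1.
Qed.
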